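(* Suppose $n$ is odd and $rels(n)\neq rols(n)$. If $B_1,B_2,\ldots,B_n$ are bases of a vector space of dimension $n$ over a field of characteristic $0$, then their multiset union can be partitioned into $n$ transversals (of the family $B_1,\ldots,B_n$) such that at least $n-1$ of them are bases.
   Context: A Latin square of order $n$ is an $n\times n$ array over the symbols $\{1,\ldots,n\}$ in which every symbol appears exactly once in each row and each column. Its $i$th row $L_i$ is regarded as the permutation of $\{1,\ldots,n\}$ sending $j$ to the entry $L_{i,j}$, and its $j$th column $L^j$ as the permutation sending $i$ to $L_{i,j}$. The sign (parity) of $L$ is $\mathrm{sgn}(L)=\prod_{i=1}^n\mathrm{sgn}(L_i)\,\mathrm{sgn}(L^i)$; $L$ is even if $\mathrm{sgn}(L)=1$ and odd if $\mathrm{sgn}(L)=-1$. $L$ is reduced if its first row and its first column are the identity permutation. $rels(n)$ and $rols(n)$ denote the numbers of reduced even and reduced odd Latin squares of order $n$, respectively. A transversal of a family $B_1,\ldots,B_n$ is a set containing exactly one element from each of the $B_j$. Since the union is a multiset, a partition of the multiset union into $n$ transversals means the following: writing $B_j=\{b_{j,1},\ldots,b_{j,n}\}$, one chooses permutations $\rho_1,\ldots,\rho_n\in S_n$ and takes as transversals the families $T_i=(b_{j,\rho_j(i)})_{j=1}^n$, $i=1,\ldots,n$; $T_i$ is a basis if its $n$ vectors are linearly independent (in particular distinct). *)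

(* Defs.v *)
From HB Require Import structures.
From mathcomp Require Import all_boot all_order all_algebra all_fingroup.

Set Implicit Arguments.
Unset Strict Implicit.
Unset Printing Implicit Defensive.

Import GRing.Theory.
Local Open Scope ring_scope.

(* Rows, columns and symbols {1, ..., n} are indexed by 'I_n = {0, ..., n-1}. *)
Definition latin (n : nat) (L : 'M['I_n]_n) : bool :=
  [forall i, forall s, #|[set j | L i j == s]| == 1%N] &&
  [forall j, forall s, #|[set i | L i j == s]| == 1%N].

(* The permutation with graph f. The default value 1 is reached only when f is
   not injective, which never happens for a row or a column of a Latin square. *)
Definition perm_of_fun (n : nat) (f : 'I_n -> 'I_n) : 'S_n :=
  insubd (1%g : 'S_n) [ffun x => f x].

Definition lrow (n : nat) (L : 'M['I_n]_n) (i : 'I_n) : 'S_n :=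
  perm_of_fun (fun j => L i j).

Definition lcol (n : nat) (L : 'M['I_n]_n) (j : 'I_n) : 'S_n :=
  perm_of_fun (fun i => L i j).

(* The exponents are permutations coerced to bool by odd_perm. *)
Definition lsgn (n : nat) (L : 'M['I_n]_n) : int :=
  \prod_(i < n) ((-1) ^+ lrow L i * (-1) ^+ lcol L i).

(* The condition i = 0 :> nat selects the first row and column for every n,
   including n = 0, where there is none. *)
Definition reduced (n : nat) (L : 'M['I_n]_n) : bool :=
  [forall i : 'I_n, (i == 0%N :> nat) ==>
     [forall j, (L i j == j) && (L j i == j)]].

Definition rels (n : nat) : nat :=
  #|[set L : 'M['I_n]_n | [&& latin L, reduced L & lsgn L == 1]]|.

Definition rols (n : nat) : nat :=
  #|[set L : 'M['I_n]_n | [&& latin L, reduced L & lsgn L == -1]]|.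

(* T_i = (b_{j, rho_j(i)})_j. As i varies, these families partition the
   multiset union of the B_j into transversals, and every such partition arises
   in this way. *)
Definition transv (V : Type) (n : nat) (B : 'I_n -> n.-tuple V)
    (rho : 'I_n -> 'S_n) (i : 'I_n) : n.-tuple V :=
  [tuple tnth (B j) (rho j i) | j < n].

(* Main.v *)
Require Import Defs.
From HB Require Import structures.
From mathcomp Require Import all_boot all_order all_algebra all_fingroup.

(** The theorem follows from a colorful determinantal identity in the style of
    Onn.  Write the vectors of the j-th basis in coordinates as the rows of a
    matrix M_j.  For arbitrary weights a_i and c_j on the permutations, expand
    the product of the sums
      sum_s a_i(s) prod_j M_j (rho_j i) (s j)
    over i, multiply by prod_j c_j(rho_j), and sum over all families rho of
    permutations.  Interchanging the two summations gives the same expression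
    with the roles of (a, rows) and (c, columns) exchanged
    ([onn_exchange]): a family sigma of permutations is now a square array L
    with L i j = sigma_i j, and the inner sum for j only sees column j of L.

    If every weight is the sign, the i-th factor on the first side is the
    determinant of the i-th transversal, the j-th inner sum on the second side
    is +-det M_j when column j of L is a permutation and 0 otherwise, and the
    whole is the signed number of Latin squares times prod_j det M_j.  In odd
    order that number is zero for n > 1, because exchanging two rows reverses
    the sign.  The remedy is to pin the first row and the first column: the
    weights a_0 and c_0 are replaced by the indicator of the identity
    permutation, and coordinates are taken with respect to the first basis, so
    that M_0 = 1 and the inner sum of column 0 becomes the indicator of that
    column being the identity.  Only reduced Latin squares survive
    ([reduced_onn_identity]), and the total is (rels n - rols n) prod_j det M_j.

    In characteristic 0 this is nonzero as soon as rels n and rols n differ, so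
    some rho contributes a nonzero term.  Each factor of that term with i != 0
    is the determinant of the i-th transversal, and these n - 1 transversals
    are therefore bases; pinning the first row has cost the information on
    transversal 0. *)

Set Implicit Arguments.
Unset Strict Implicit.
Unset Printing Implicit Defensive.

Import GRing.Theory.
Local Open Scope ring_scope.

(** Multiplying a row vector by the matrix of coordinates gives the coordinates
    of the corresponding linear combination of X, so a linear relation on X is
    an element of the left kernel of this matrix. *)
Lemma free_det_coord (F : fieldType) (V : vectType F) (n : nat)
    (b X : n.-tuple V) (b_basis : basis_of {:V} b) :
  free X = (\det (\matrix_(j, k) coord b k (tnth X j)) != 0).
Proof.
set A := \matrix_(_, _) _.
have mulA (v : 'rV_n) k : (v *m A) 0 k = coord b k (\sum_j v 0 j *: X`_j).
  rewrite mxE linear_sum; apply: eq_bigr => j _.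
  by rewrite mxE linearZ (tnth_nth 0).
apply/idP/idP => [/freeP X_free | detA].
  apply/det0P => -[v /eqP v_neq0 vA0]; apply: v_neq0.
  apply/rowP => j; rewrite mxE; apply: X_free j.
  rewrite [LHS](coord_basis b_basis (memvf _)) big1 // => k _.
  by rewrite -mulA vA0 mxE scale0r.
apply/freeP => k sum0 j.
suff /rowP/(_ j) : \row_j k j = 0 by rewrite !mxE.
apply/eqP; apply: contraNT detA => k_neq0.
apply/det0P; exists (\row_j k j) => //; apply/rowP => l; rewrite mulA.
by under eq_bigr do rewrite mxE; rewrite sum0 linear0 mxE.
Qed.

Lemma basis_det_coord (F : fieldType) (V : vectType F) (n : nat)
    (b X : n.-tuple V) (b_basis : basis_of {:V} b) :
  basis_of {:V} X = (\det (\matrix_(j, k) coord b k (tnth X j)) != 0).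
Proof.
by rewrite -free_det_coord // basisEfree subvf (size_basis b_basis) size_tuple
           leqnn !andbT.
Qed.

Lemma perm_of_funE (n : nat) (f : 'I_n -> 'I_n) :
  injective f -> perm_of_fun f =1 f.
Proof.
move=> f_inj x; rewrite -pvalE [pval _]val_insubd.
by case: injectiveP => [_|[]]; rewrite ?ffunE // => y z; rewrite !ffunE => /f_inj.
Qed.

(** Selecting columns by a bijection permutes them; a repeated column makes the
    transpose have two equal rows. *)
Lemma det_colsub (R : comNzRingType) (n : nat) (f : 'I_n -> 'I_n) (A : 'M[R]_n) :
  \det (colsub f A) =
    if injectiveb f then (-1) ^+ perm_of_fun f * \det A else 0.
Proof.
case: injectiveP => [f_inj | /injectiveP].
  rewrite mulrC -odd_permV -det_perm -det_mulmx -col_permE; congr (\det _).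
  by apply/matrixP => i j; rewrite !mxE perm_of_funE.
case/injectivePn=> i [j i_neq_j fij].
by rewrite -det_tr (determinant_alternate i_neq_j) // => k; rewrite !mxE fij.
Qed.

(** The left-hand side is the Leibniz expansion, along columns, of the
    determinant of [colsub f A].  With [f] a column of an array, this is how the
    Latin condition on columns arises. *)
Lemma sum_perm_prod (R : comNzRingType) (n : nat) (f : 'I_n -> 'I_n) (A : 'M[R]_n) :
  \sum_(s : 'S_n) (-1) ^+ s * \prod_i A (s i) (f i) =
    if injectiveb f then (-1) ^+ perm_of_fun f * \det A else 0.
Proof.
rewrite -det_colsub -det_tr; apply: eq_bigr => s _; congr (_ * _).
by apply: eq_bigr => i _; rewrite !mxE.
Qed.

(** Distributing the product of sums turns either side into the double sum over
    rho and sigma of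
      prod_j c_j(rho_j) prod_i a_i(sigma_i) prod_(i,j) M_j (rho_j i) (sigma_i j).
    Leaving the weights arbitrary is what allows the first row and column to be
    pinned later. *)
Lemma onn_exchange (R : comNzRingType) (n : nat) (M : 'I_n -> 'M[R]_n)
    (a c : 'I_n -> 'S_n -> R) :
  \sum_(rho : {ffun 'I_n -> 'S_n}) \prod_j c j (rho j) *
    \prod_i (\sum_s a i s * \prod_j M j (rho j i) (s j)) =
  \sum_(sigma : {ffun 'I_n -> 'S_n}) \prod_i a i (sigma i) *
    \prod_j (\sum_r c j r * \prod_i M j (r i) (sigma i j)).
Proof.
under eq_bigr do rewrite bigA_distr_bigA big_distrr.
under [RHS]eq_bigr do rewrite bigA_distr_bigA big_distrr.
rewrite exchange_big; apply: eq_bigr => sigma _; apply: eq_bigr => rho _ /=.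
by rewrite !big_split /= mulrCA; congr (_ * (_ * _)); rewrite exchange_big.
Qed.

Lemma latinP (n : nat) (L : 'M['I_n]_n) :
  reflect ((forall i, injective (L i)) /\ (forall j, injective (L^~ j)))
          (latin L).
Proof.
have fibres (f : 'I_n -> 'I_n) :
    injective f <-> forall s, #|[set x | f x == s]| == 1%N.
  split=> [f_inj s | f_fib x y fxy].
    apply/cards1P; exists (invF f_inj s); apply/setP => x.
    by rewrite !inE (can2_eq (invF_f f_inj) (f_invF f_inj)).
  have /cards1P[z fib] := f_fib (f x).
  have: x \in [set z] by rewrite -fib inE.
  have: y \in [set z] by rewrite -fib inE fxy.
  by rewrite !inE => /eqP -> /eqP ->.
apply: (iffP andP) => -[rows cols]; split.
- by move=> i; apply/fibres; apply/forallP; apply: (forallP rows).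
- by move=> j; apply/fibres; apply/forallP; apply: (forallP cols).
- by apply/forallP => i; apply/forallP/fibres.
- by apply/forallP => j; apply/forallP/(fibres (L^~ j)).
Qed.

Lemma reducedP (m : nat) (L : 'M['I_m.+1]_m.+1) :
  reflect ((forall j, L ord0 j = j) /\ (forall i, L i ord0 = i)) (reduced L).
Proof.
apply: (iffP forallP) => [red | [row0 col0] i].
  by have /forallP{}red := implyP (red ord0) isT;
     split=> j; case/andP: (red j) => /eqP ? /eqP.
apply/implyP => /eqP i0; have -> : i = ord0 by apply: val_inj.
by apply/forallP => j; rewrite row0 col0 !eqxx.
Qed.

(** Every sign is 1 or -1, so the signed count of reduced Latin squares is the
    difference between the numbers of even and of odd ones. *)
Lemma sum_lsgn (n : nat) :
  \sum_(L : 'M['I_n]_n | latin L && reduced L) lsgn L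
    = (rels n)%:Z - (rols n)%:Z.
Proof.
have lsgn_pm1 (L : 'M['I_n]_n) : (lsgn L == 1) || (lsgn L == -1).
  rewrite /lsgn; elim/big_rec: _ => //= i x _.
  by do 2!case: (odd_perm _); case/orP=> /eqP ->.
rewrite (bigID (fun L => lsgn L == 1)) /=; congr (_ + _).
  rewrite (eq_bigr (fun=> 1)) => [|L /andP[_ /eqP //]].
  rewrite sumr_const natz; congr (Posz _); apply: eq_card => L.
  by rewrite !inE andbA.
rewrite (eq_bigr (fun=> -1)) => [|L /andP[_]]; last first.
  by case/orP: (lsgn_pm1 L) => /eqP ->.
rewrite sumr_const mulNrn natz; congr (- Posz _); apply: eq_card => L.
rewrite !inE andbA; congr (_ && _).
by case/orP: (lsgn_pm1 L) => /eqP ->.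
Qed.

Lemma intr_pchar0_eq0 (F : fieldType) (F_char0 : [pchar F] =i pred0) (z : int) :
  (z%:~R == 0 :> F) = (z == 0).
Proof.
have natr_eq0 := (pcharf0P F).1 F_char0.
by case: z => k; rewrite ?NegzE ?mulrNz ?oppr_eq0 -pmulrn natr_eq0.
Qed.

Definition pinned_sign (R : pzRingType) (m : nat) (i : 'I_m.+1) (s : 'S_m.+1) : R :=
  if i == ord0 then (s == 1%g)%:R else (-1) ^+ s.

(** The analogue of [pinned_sign] for a column of an array whose rows are
    permutations, where injectivity is not automatic. *)
Definition pinned_column_sign (R : pzRingType) (m : nat) (j : 'I_m.+1)
    (f : 'I_m.+1 -> 'I_m.+1) : R :=
  if injectiveb f && ((j == ord0) ==> [forall i, f i == i])
  then (-1) ^+ perm_of_fun f else 0.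

(** For [j != ord0] this is the determinant expansion above.  For [j = ord0] only
    [r = 1] contributes, with the product of the entries of the identity matrix
    at (i, f i), which vanishes unless [f] is the identity. *)
Lemma sum_pinned_sign_prod (R : comNzRingType) (m : nat) (A : 'M[R]_m.+1)
    (j : 'I_m.+1) (f : 'I_m.+1 -> 'I_m.+1) (A1 : j = ord0 -> A = 1%:M) :
  \sum_r pinned_sign R j r * \prod_i A (r i) (f i) =
    pinned_column_sign R j f * \det A.
Proof.
rewrite /pinned_sign /pinned_column_sign; case: eqP => [/A1 -> | _]; last first.
  by rewrite sum_perm_prod andbT; case: ifP => //; rewrite mul0r.
rewrite (bigD1 1%g) //= [X in _ + X]big1 ?addr0 => [|r /negPf ->]; last first.
  by rewrite mul0r.
rewrite eqxx mul1r det1 mulr1.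
case: (boolP [forall i, f i == i]) => [/forallP f_id | ].
  have f_inj : injective f by move=> x y; rewrite (eqP (f_id x)) (eqP (f_id y)).
  rewrite (introT (injectiveP _) f_inj) /=.
  have -> : perm_of_fun f = 1%g.
    by apply/permP => x; rewrite perm_of_funE // perm1 (eqP (f_id x)).
  rewrite odd_perm1 expr0 big1 // => i _.
  by rewrite perm1 (eqP (f_id i)) mxE eqxx.
rewrite andbF => /forallPn[i /negPf fi].
by rewrite (bigD1 i) //= perm1 mxE eq_sym fi mul0r.
Qed.

(** After the exchange, the summand at sigma is the sign of the array with rows
    sigma_i times the product of the determinants if that array is a reduced
    Latin square, and one of its pinned factors vanishes otherwise. *)
Lemma reduced_onn_identity (R : comNzRingType) (m : nat)
    (M : 'I_m.+1 -> 'M[R]_m.+1) (M0 : M ord0 = 1%:M) :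
  \sum_(rho : {ffun 'I_m.+1 -> 'S_m.+1}) \prod_j pinned_sign R j (rho j) *
    \prod_i (\sum_s pinned_sign R i s * \prod_j M j (rho j i) (s j)) =
  ((rels m.+1)%:Z - (rols m.+1)%:Z)%:~R * \prod_j \det (M j).
Proof.
set N := m.+1.
pose sq (sigma : {ffun 'I_N -> 'S_N}) : 'M['I_N]_N := \matrix_(i, j) sigma i j.
rewrite onn_exchange -sum_lsgn rmorph_sum big_distrl /=.
have cols (f : 'I_N -> 'I_N) j :
    \sum_r pinned_sign R j r * \prod_i M j (r i) (f i) =
    pinned_column_sign R j f * \det (M j).
  by apply: sum_pinned_sign_prod => ->.
have sq_row sigma i : lrow (sq sigma) i = sigma i.
  apply/permP => j; rewrite perm_of_funE ?mxE // => x y.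
  by rewrite !mxE => /perm_inj.
rewrite [RHS](reindex_onto sq (fun L => [ffun i => lrow L i])) /=; last first.
  move=> L /andP[/latinP[rows _] _]; apply/matrixP => i j.
  by rewrite mxE ffunE perm_of_funE.
rewrite [RHS]big_mkcond /=; apply: eq_bigr => sigma _.
have -> : [ffun i => lrow (sq sigma) i] = sigma.
  by apply/ffunP => i; rewrite ffunE sq_row.
rewrite eqxx andbT; under [X in _ * X]eq_bigr do rewrite cols.
rewrite big_split /= mulrA.
case: ifP => [/andP[/latinP[_ inj_cols] /reducedP[row0 col0]] | not_lr].
  rewrite /lsgn rmorph_prod /=; congr (_ * _); rewrite -big_split /=.
  apply: eq_bigr => i _; rewrite rmorphM !rmorph_sign /= sq_row; congr (_ * _).
    rewrite /pinned_sign; case: eqP => // ->.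
    have -> : sigma ord0 = 1%g.
      by apply/permP => j; have := row0 j; rewrite mxE perm1.
    by rewrite eqxx odd_perm1.
  have inj_col : injective (fun k => sigma k i).
    by apply: eq_inj (inj_cols i) _ => k; rewrite mxE.
  rewrite /pinned_column_sign (introT (injectiveP _) inj_col) /=.
  have -> : (i == ord0) ==> [forall k, sigma k i == k].
    apply/implyP => /eqP ->; apply/forallP => k.
    by have := col0 k; rewrite mxE => ->.
  congr (_ ^+ odd_perm _); apply/permP => k.
  by rewrite perm_of_funE // (perm_of_funE (inj_cols i)) mxE.
suff -> : \prod_i pinned_sign R i (sigma i) *
    \prod_j pinned_column_sign R j (fun i => sigma i j) = 0 by rewrite mul0r.
have [sigma0 | sigma0] := eqVneq (sigma ord0) 1%g; last first.
  by rewrite (bigD1 ord0) //= /pinned_sign eqxx (negPf sigma0) !mul0r.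
have [/forallP all_cols | /forallPn[j /negPf bad_col]] :=
  boolP [forall j, injectiveb (fun i => sigma i j) &&
                   ((j == ord0) ==> [forall i, sigma i j == i])].
  case/negP: (negbT not_lr); apply/andP; split.
    apply/latinP; split=> [i x y | j x y]; rewrite !mxE; first exact: perm_inj.
    by case/andP: (all_cols j) => /injectiveP/(_ x y).
  apply/reducedP; split=> [j | i]; rewrite mxE ?sigma0 ?perm1 //.
  by case/andP: (all_cols ord0) => _ /forallP/(_ i)/eqP.
by rewrite [X in _ * X](bigD1 j) //= /pinned_column_sign bad_col mul0r mulr0.
Qed.

Theorem theorem3p3 (n : nat) (n_odd : odd n) (rels_neq_rols : rels n <> rols n)
    (F : fieldType) (F_char0 : [pchar F] =i pred0)
    (V : vectType F) (dimV : \dim {:V} = n)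
    (B : 'I_n -> n.-tuple V) (B_basis : forall j, basis_of {:V} (B j)) :
  exists rho : 'I_n -> 'S_n,
    (n.-1 <= #|[set i : 'I_n | basis_of {:V} (transv B rho i)]|)%N.
Proof.
case: n => [//|m] in n_odd rels_neq_rols dimV B B_basis *.
pose b := B ord0; have b_basis : basis_of {:V} b := B_basis ord0.
pose M j : 'M[F]_m.+1 := \matrix_(i, k) coord b k (tnth (B j) i).
have M0 : M ord0 = 1%:M.
  apply/matrixP => i k.
  by rewrite !mxE (tnth_nth 0) coord_free ?(basis_free b_basis).
have := reduced_onn_identity M0.
have rhs_neq0 : ((rels m.+1)%:Z - (rols m.+1)%:Z)%:~R * \prod_j \det (M j) != 0.
  rewrite mulf_neq0 ?intr_pchar0_eq0 ?subr_eq0 //.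
    by apply/eqP => -[].
  by apply/prodf_neq0 => j _; rewrite -basis_det_coord.
have [rho + | sum0] := pickP (fun rho : {ffun 'I_m.+1 -> 'S_m.+1} =>
  \prod_j pinned_sign F j (rho j) *
    \prod_i (\sum_s pinned_sign F i s * \prod_j M j (rho j i) (s j)) != 0); last first.
  move=> identity; case/eqP: rhs_neq0; rewrite -identity big1 // => rho _.
  by apply/eqP; rewrite -[_ == _]negbK sum0.
rewrite mulf_eq0 negb_or => /andP[_ /prodf_neq0 T_neq0] _.
exists rho; apply: (@leq_trans #|[set~ (ord0 : 'I_m.+1)]|).
  by rewrite cardsC1 card_ord.
apply/subset_leq_card/subsetP => i; rewrite !inE => /negPf i_neq0.
rewrite (basis_det_coord _ b_basis).
have := T_neq0 i isT; rewrite /pinned_sign i_neq0.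
congr (_ != 0); apply: eq_bigr => s _; congr (_ * _).
by apply: eq_bigr => j _; rewrite !mxE tnth_mktuple.
Qed.
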